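(* Let $(W,S)$ be a Coxeter system. Consider the random walk on $W$ started at the identity $1_W$ which, at each step, multiplies the current element on the right by an element chosen uniformly at random from $S \cup \{1_W\}$ (i.e. by each $s\in S$ or by $1_W$, each with probability $\frac{1}{|S|+1}$). Let $P^n(x)$ denote the probability that the walk is at $x\in W$ after $n$ steps. Then for every $n \geq 0$ and all $w, w' \in W$ with $w \leq_B w'$, we have $P^n(w) \geq P^n(w')$.
   Context: A Coxeter system $(W,S)$ is a group $W$ with generating set $S=\{s_1,\dots,s_k\}$ and presentation $\langle s_1,\dots,s_k \mid s_i^2,\ (s_is_j)^{m_{ij}}\ (i\neq j)\rangle$, where each $m_{ij}$ ($i\ne j$) is an integer $\geq 2$ or $\infty$ (meaning no relation). For $x\in W$, $l(x)$ is the length of a shortest word in $S$ representing $x$. The (right) weak Bruhat order $\leq_B$ on $W$ is defined by $w \leq_B w'$ iff there is a reduced word for $w$ which can be extended by multiplying on the right by elements of $S$ to obtain a reduced word for $w'$; equivalently, some shortest path from $1_W$ to $w'$ in the Cayley graph $\Gamma(W,S)$ (edges $x$ — $xs$ for $s\in S$) passes through $w$. *)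

(* Defs.v *)
From HB Require Import structures.
From mathcomp Require Import all_boot all_order all_algebra finmap.

Set Implicit Arguments.
Unset Strict Implicit.
Unset Printing Implicit Defensive.

Import Order.TTheory GRing.Theory Num.Theory.

Local Open Scope fset_scope.
Local Open Scope group_scope.

Section Presentation.
Variable I : Type.

(* (i, false) stands for the generator i, (i, true) for its formal inverse. *)
Definition letter := (I * bool)%type.
Definition invl (a : letter) : letter := (a.1, ~~ a.2).

(* The congruence on words whose quotient is the group <I | R>. *)
Inductive pres_eq (R : seq letter -> Prop) : seq letter -> seq letter -> Prop :=
| pres_refl u : pres_eq R u u
| pres_sym u v : pres_eq R u v -> pres_eq R v u
| pres_trans u v w : pres_eq R u v -> pres_eq R v w -> pres_eq R u w
| pres_cat u u' v v' :
    pres_eq R u u' -> pres_eq R v v' -> pres_eq R (u ++ v) (u' ++ v')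
| pres_cancel a : pres_eq R [:: a; invl a] [::]
| pres_rel r : R r -> pres_eq R r [::].

Variables (G : groupType) (g : I -> G).

Definition eval_letter (a : letter) : G := if a.2 then (g a.1)^-1 else g a.1.
Definition eval_word (u : seq letter) : G := \prod_(a <- u) eval_letter a.

(* G = <I | R>, the generator i being sent to g i. *)
Definition has_presentation (R : seq letter -> Prop) : Prop :=
  (forall x : G, exists u, eval_word u = x) /\
  (forall u v, eval_word u = eval_word v <-> pres_eq R u v).

End Presentation.

Section Coxeter.
Variable W : groupType.

(* None encodes m = oo. The diagonal of m is not used. *)
Definition coxeter_coefficients (S : {fset W}) (m : S -> S -> option nat) :=
  forall s t : S, s != t ->
    m s t = m t s /\ (forall k, m s t = Some k -> 2 <= k).

Inductive coxeter_relator (S : {fset W}) (m : S -> S -> option nat) :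
    seq (letter S) -> Prop :=
| square_relator (s : S) : coxeter_relator m [:: (s, false); (s, false)]
| braid_relator (s t : S) k : s != t -> m s t = Some k ->
    coxeter_relator m (flatten (nseq k [:: (s, false); (t, false)])).

Definition coxeter_system (S : {fset W}) : Prop :=
  exists m : S -> S -> option nat,
    coxeter_coefficients m /\
    has_presentation (fun s : S => val s) (coxeter_relator m).

Definition S_word (S : {fset W}) (u : seq W) : Prop := {subset u <= S}.

Definition word_prod (u : seq W) : W := \prod_(x <- u) x.

Definition reduced_word (S : {fset W}) (u : seq W) (x : W) : Prop :=
  [/\ S_word S u, word_prod u = x &
      forall v, S_word S v -> word_prod v = x -> size u <= size v].

Definition weak_le (S : {fset W}) (w w' : W) : Prop :=
  exists u v : seq W, reduced_word S u w /\ reduced_word S (u ++ v) w'.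

Definition walk_steps (S : {fset W}) : {fset W} := 1 |` S.

Definition step_prob (S : {fset W}) (u : W) : rat :=
  (if u \in walk_steps S then #|` walk_steps S|%:R^-1 else 0)%R.

(* The walk from 1 with independent increments u_1, ..., u_n is at
   u_1 * ... * u_n after n steps. *)
Definition walk_prob (S : {fset W}) (n : nat) (x : W) : rat :=
  (\sum_(t : n.-tuple (walk_steps S) | word_prod (map val t) == x)
     \prod_(u <- t) step_prob S (val u))%R.

(* All relators have even length, so no generator is trivial. *)
Lemma pres_eq_odd (S : {fset W}) (m : S -> S -> option nat) u v :
  pres_eq (coxeter_relator m) u v -> odd (size u) = odd (size v).
Proof.
elim=> //= [???? -> //|????? E1 ? E2|r].
- by rewrite !size_cat !oddD E1 E2.
- case=> // s t k _ _; elim: k => //= k; by rewrite negbK.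
Qed.

Lemma card_walk_steps (S : {fset W}) :
  coxeter_system S -> #|` walk_steps S| = #|` S|.+1.
Proof.
move=> [m [_ [_ pres]]]; rewrite cardfsU1.
case: (boolP (1 \in S)) => [S1|//].
have /pres/pres_eq_odd // : eval_word (fun s : S => val s) [:: ([` S1], false)]
  = eval_word (fun s : S => val s) [::].
by rewrite /eval_word big_seq1 big_nil.
Qed.

End Coxeter.

(* Main.v *)
(* Let l(ws) > l(w) and let t = w s w^-1, so that ws = tw.  A word x_1 ... x_n
   crosses the wall of t when t = y x_i y^-1 for some proper prefix product
   y = x_1 ... x_(i-1).  The parity of the number of crossings depends only on
   the element of W which the word represents, because it is even for each
   relator; it is odd for ws, hence every path of the walk from 1 to ws
   crosses the wall of t.  Now take the first step of the path that either
   crosses this wall or stays at an element adjacent to it, and exchange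
   crossing with staying: this reflects the rest of the path in t.  It is an
   involution of the paths of length n, and it sends the paths to ws = tw to
   paths to w. *)
Require Import Defs.
From mathcomp Require Import all_boot all_order all_algebra finmap.

Set Implicit Arguments.
Unset Strict Implicit.
Unset Printing Implicit Defensive.

Import Order.TTheory GRing.Theory Num.Theory.

Local Open Scope fset_scope.
Local Open Scope group_scope.

(** * Walls crossed by a word, in an arbitrary group *)

Section Reflections.
Variable W : groupType.
Implicit Types (x y s t : W) (u v : seq W).

Fixpoint reflections u : seq W :=
  if u is x :: u' then x :: [seq y ^ x^-1 | y <- reflections u'] else [::].

Definition crossing_parity u t : bool := odd (count_mem t (reflections u)).

Lemma word_prod_nil : word_prod [::] = 1 :> W.
Proof. exact: big_nil. Qed.

Lemma word_prod_cons x u : word_prod (x :: u) = x * word_prod u.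
Proof. exact: big_cons. Qed.

Lemma word_prod_cat u v : word_prod (u ++ v) = word_prod u * word_prod v.
Proof. exact: big_cat. Qed.

Lemma conjg_invE x y : y ^ x^-1 = x * y * x^-1.
Proof. by rewrite conjgE invgK mulgA. Qed.

Lemma count_mem_conjg x t u :
  count_mem t [seq y ^ x^-1 | y <- u] = count_mem (t ^ x) u.
Proof.
rewrite count_map; apply: eq_count => y /=.
by apply/eqP/eqP => [<-|->]; rewrite ?conjgKV ?conjgK.
Qed.

Lemma reflections_cat u v :
  reflections (u ++ v) =
  reflections u ++ [seq y ^ (word_prod u)^-1 | y <- reflections v].
Proof.
elim: u => [|x u IHu] /=.
  by rewrite word_prod_nil invg1 -[LHS]map_id; apply: eq_map => y; rewrite conjg1.
rewrite IHu map_cat -map_comp word_prod_cons; congr (_ :: _ ++ _).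
by apply: eq_map => y /=; rewrite invgM conjgM.
Qed.

Lemma crossing_parity_cat u v t :
  crossing_parity (u ++ v) t =
  crossing_parity u t (+) crossing_parity v (t ^ word_prod u).
Proof.
by rewrite /crossing_parity reflections_cat count_cat oddD count_mem_conjg.
Qed.

Lemma crossing_parity_cons x u t :
  crossing_parity (x :: u) t = (x == t) (+) crossing_parity u (t ^ x).
Proof. by rewrite /crossing_parity /= oddD oddb count_mem_conjg. Qed.

Lemma crossing_parity_square s t : s * s = 1 -> crossing_parity [:: s; s] t = false.
Proof.
move=> ss; rewrite !crossing_parity_cons addbA [X in _ (+) X]/= addbF.
suff -> : (s == t ^ s) = (s == t) by rewrite addbb.
apply/eqP/eqP => [e|<-]; last by rewrite conjgE mulKg.
by apply: (@conjg_inj _ s); rewrite -e conjgE mulKg.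
Qed.

(* The conjugate [c^i s c^-i] is [c^(2i) s], since [s] inverts [c = s t]. *)
Lemma reflections_alternating s t k : s * s = 1 -> t * t = 1 ->
  reflections (flatten (nseq k [:: s; t])) =
  [seq (s * t) ^+ j * s | j <- iota 0 k.*2].
Proof.
move=> ss tt; have sV : s^-1 = s by apply: (mulgI s); rewrite mulgV ss.
have tV : t^-1 = t by apply: (mulgI t); rewrite mulgV tt.
elim: k => [|k IHk] //=; rewrite IHk expg0 mul1g expg1 conjg_invE sV.
congr [:: _, _ & _]; rewrite -[2%N]/(2 + 0)%N iotaDl -!map_comp.
apply: eq_map => j /=; rewrite conjg_invE conjgE sV tV.
by rewrite add2n expgS expgSr !mulgA.
Qed.

(** As [(s * t) ^+ k = 1], the [2k] reflections of this word are one list of length [k] repeated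
    twice. *)
Lemma crossing_parity_alternating s t k r : s * s = 1 -> t * t = 1 ->
  (s * t) ^+ k = 1 -> crossing_parity (flatten (nseq k [:: s; t])) r = false.
Proof.
move=> ss tt st1; rewrite /crossing_parity reflections_alternating //.
rewrite -addnn iotaD add0n map_cat.
rewrite count_cat oddD [X in _ (+) odd (count _ X)](_ : _ =
  [seq (s * t) ^+ j * s | j <- iota 0 k]) ?addbb //.
rewrite -[X in iota X]addn0 iotaDl -map_comp.
by apply: eq_map => j /=; rewrite expgnDr st1 mul1g.
Qed.

(** If [t = y * x * y^-1] with [y] the product of the letters before [x], then deleting [x]
    multiplies the product by [t^-1] on the left. *)
Lemma mem_reflections_shorten u t : t \in reflections u ->
  exists v, [/\ {subset v <= u}, word_prod v = t^-1 * word_prod u &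
                size u = (size v).+1].
Proof.
elim: u t => //= x u IHu t; rewrite inE => /predU1P[->|/mapP[y yu ->]].
  exists u; split=> // [z zu|]; first by rewrite inE zu orbT.
  by rewrite word_prod_cons mulKg.
have [v [vu vp ->]] := IHu y yu; exists (x :: v); split=> //.
  by move=> z; rewrite !inE => /predU1P[->|/vu ->]; rewrite ?eqxx ?orbT.
by rewrite !word_prod_cons vp conjg_invE !invgM invgK !mulgA mulgVK.
Qed.

Lemma word_prod_filter1 u : word_prod (filter (predC1 1) u) = word_prod u.
Proof.
elim: u => //= x u IHu; case: eqP => [->|_] /=; rewrite !word_prod_cons IHu //.
by rewrite mul1g.
Qed.

(** Allows for walk paths that stay put: a letter [1] crosses only the wall of [1] and conjugates
    trivially. *)
Lemma crossing_parity_filter1 u t : t != 1 ->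
  crossing_parity (filter (predC1 1) u) t = crossing_parity u t.
Proof.
elim: u t => //= x u IHu t t1; case: (eqVneq x 1) => [->|x1] /=.
  by rewrite crossing_parity_cons eq_sym (negPf t1) conjg1 IHu.
by rewrite !crossing_parity_cons IHu ?conjg_eq1.
Qed.

End Reflections.

(** * Invariance of the crossing parity under the Coxeter relations *)

Section CoxeterParity.
Variables (W : groupType) (S : {fset W}) (m : S -> S -> option nat).
Hypothesis pres : has_presentation (fun s : S => val s) (coxeter_relator m).

Let word (a : seq (letter S)) : seq W := [seq val x.1 | x <- a].

Lemma coxeter_generator_sq s : s \in S -> s * s = 1.
Proof.
move=> sS; have [_ /(_ _ _)/iffRL/(_ (pres_rel (square_relator m [` sS])))] := pres.
by rewrite /eval_word big_cons big_seq1 big_nil.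
Qed.

Lemma eval_word_generators a : eval_word (fun s : S => val s) a = word_prod (word a).
Proof.
rewrite /eval_word /word_prod big_map; apply: eq_bigr => -[s []] _ //=.
rewrite /eval_letter /=; apply: (mulgI (val s)).
by rewrite mulgV (coxeter_generator_sq (fsvalP s)).
Qed.

Lemma pres_eq_crossing_parity a b : pres_eq (coxeter_relator m) a b ->
  crossing_parity (word a) =1 crossing_parity (word b).
Proof.
elim=> {a b} [//|a b _ IH t|a b c _ IHa _ IHb t|a a' b b' aa' IHa _ IHb t|a t|r].
- by rewrite IH.
- by rewrite IHa IHb.
(* The second factor is tested at [t] conjugated by the product of the first, so the equality of
   these products in [W] is needed too. *)
- rewrite /word !map_cat !crossing_parity_cat -/word IHa IHb.
  by case: pres => _ /(_ a a')/iffRL/(_ aa'); rewrite !eval_word_generators => ->.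
- by rewrite [LHS]crossing_parity_square // coxeter_generator_sq ?fsvalP.
- case=> [s t|s s' k ss' mk t].
    by rewrite [LHS]crossing_parity_square // coxeter_generator_sq ?fsvalP.
  have := iffRL (pres.2 _ _) (pres_rel (braid_relator ss' mk)).
  rewrite !eval_word_generators.
  have -> : word (flatten (nseq k [:: (s, false); (s', false)])) =
            flatten (nseq k [:: val s; val s']).
    by rewrite /word map_flatten map_nseq.
  rewrite word_prod_nil => e.
  rewrite crossing_parity_alternating ?coxeter_generator_sq ?fsvalP //.
  rewrite -e; elim: (k) => [|j IHj]; first by rewrite word_prod_nil.
  by rewrite expgS IHj /= !word_prod_cons mulgA.
Qed.

Lemma S_word_letters u : S_word S u -> exists a, word a = u.
Proof.
elim: u => [|x u IHu] Su; first by exists [::].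
have [|a <-] := IHu; first by move=> y yu; apply: Su; rewrite inE yu orbT.
have xS : x \in S by apply: Su; rewrite mem_head.
by exists (([` xS], false) :: a).
Qed.

Lemma eq_word_prod_crossing_parity u v :
    S_word S u -> S_word S v -> word_prod u = word_prod v ->
  crossing_parity u =1 crossing_parity v.
Proof.
move=> /S_word_letters[a <-] /S_word_letters[b <-].
by rewrite -!eval_word_generators => /pres.2/pres_eq_crossing_parity.
Qed.

End CoxeterParity.

(** * Reflecting walk paths and comparing probabilities *)

Section Walk.
Variables (W : groupType) (S : {fset W}).
Implicit Types (t : W) (u : seq (walk_steps S)).

Lemma walk_path_crosses r s u : coxeter_system S ->
    reduced_word S (rcons r s) (word_prod r * s) ->
    word_prod (map val u) = word_prod r * s ->
  s ^ (word_prod r)^-1 \in reflections (map val u).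
Proof.
case=> m [_ pres] [Srs _ min_rs] eu; set t := s ^ _.
have Sr : S_word S r by move=> x xr; apply: Srs; rewrite mem_rcons inE xr orbT.
have sS : s \in S by apply: Srs; rewrite mem_rcons mem_head.
have t_prod : t^-1 * word_prod r = word_prod r * s.
  rewrite /t -conjVg conjg_invE mulgVK; congr (_ * _).
  by apply: (mulgI s); rewrite mulgV (coxeter_generator_sq pres).
have t1 : t != 1.
  apply/eqP=> t1; have := min_rs r Sr; rewrite -t_prod t1 invg1 mul1g => /(_ erefl).
  by rewrite size_rcons ltnn.
(* Otherwise deleting a letter of [r] would spell [word_prod r * s] with fewer letters than the
   reduced word [rcons r s]. *)
have t_r : t \notin reflections r.
  apply/negP => /mem_reflections_shorten[v [vr vp vs]].
  have /(_ _ _)/= := min_rs v; rewrite size_rcons vs vp t_prod.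
  by move=> /(_ (fun x xv => Sr x (vr x xv)) erefl); rewrite ltnNge leqnSn.
suff : crossing_parity (map val u) t.
  by rewrite /crossing_parity; case: (boolP (t \in _)) => // /count_memPn ->.
rewrite -crossing_parity_filter1 //.
rewrite (eq_word_prod_crossing_parity pres (v := rcons r s)) //.
(* [r] does not cross the wall of [t], and the last letter [s] crosses it once. *)
- rewrite -cats1 crossing_parity_cat {1}/crossing_parity (count_memPn t_r) /=.
  by rewrite crossing_parity_cons /t conjgKV eqxx.
- move=> x; rewrite mem_filter => /andP[/= x1 /mapP[y _ xy]].
  by have := fsvalP y; rewrite -xy !inE (negPf x1).
- by rewrite word_prod_filter1 eu -cats1 word_prod_cat word_prod_cons word_prod_nil mulg1.
Qed.

(* Wherever [t] is a step, [x |-> x^-1 * t] exchanges the steps [1] and [t];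
   [insubd] is then never at its default value. *)
Fixpoint reflect_path t u : seq (walk_steps S) :=
  if u is x :: u' then
    if (t \in walk_steps S) && (fsval x \in [:: 1; t])
    then insubd x ((fsval x)^-1 * t) :: u'
    else x :: reflect_path (t ^ fsval x) u'
  else [::].

Lemma size_reflect_path t u : size (reflect_path t u) = size u.
Proof. by elim: u t => //= x u IHu t; case: ifP => //= _; rewrite IHu. Qed.

Lemma val_swapped_step t (x : walk_steps S) :
    t \in walk_steps S -> fsval x \in [:: 1; t] ->
  fsval (insubd x ((fsval x)^-1 * t)) = (fsval x)^-1 * t.
Proof.
move=> tS; rewrite !inE => xt; rewrite [LHS]val_insubd ifT //.
case/orP: xt => /eqP ->; first by rewrite invg1 mul1g.
by rewrite mulVg !inE eqxx.
Qed.

(** The steps before the swap are kept and the swapped step stays in [{1, t}], so a second pass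
    swaps at the same place. *)
Lemma reflect_pathK t : involutive (reflect_path t).
Proof.
move=> u; elim: u t => //= x u IHu t; case: ifP => [/andP[tS xt]|xt] /=; last first.
  by rewrite xt IHu.
have e := val_swapped_step tS xt; rewrite tS e ifT; last first.
  by move: xt; rewrite /= !inE => /orP[]/eqP ->; rewrite ?invg1 ?mul1g ?mulVg eqxx ?orbT.
congr (_ :: _); apply: val_inj.
have e' : ((fsval x)^-1 * t)^-1 * t = fsval x.
  by move: xt; rewrite !inE => /orP[]/eqP ->; rewrite ?invg1 ?mul1g ?mulVg ?invg1 ?mul1g.
by rewrite e' val_insubd fsvalP.
Qed.

Lemma word_prod_reflect_path t u : t * t = 1 -> t \in reflections (map val u) ->
  word_prod (map val (reflect_path t u)) = t * word_prod (map val u).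
Proof.
elim: u t => //= x u IHu t tt; rewrite inE => t_u.
case: ifP => [/andP[tS xt]|xt] /=.
  rewrite val_swapped_step // !word_prod_cons mulgA; congr (_ * _).
  by move: xt; rewrite !inE => /orP[]/eqP ->; rewrite ?invg1 ?mul1g ?mulg1 ?mulVg ?tt.
rewrite !word_prod_cons IHu; first by rewrite conjgE !mulgA mulgV mul1g.
  by rewrite -conjMg tt conj1g.
(* A crossing [x = t] would have been swapped, since then [t] is itself a step; so the crossing lies
   further on. *)
case/predU1P: t_u xt => [->|/mapP[y yu ->] _]; last by rewrite conjgKV.
by rewrite (fsvalP x) !inE eqxx orbT.
Qed.

(** All paths of length [n] have equal weight, so comparing probabilities amounts to counting
    paths. *)
Lemma walk_probE n x : walk_prob S n x =
  (#|[set p : n.-tuple (walk_steps S) | word_prod (map val p) == x]|%:R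
     * #|` walk_steps S|%:R^-1 ^+ n)%R.
Proof.
rewrite /walk_prob (eq_bigr (fun=> #|` walk_steps S|%:R^-1 ^+ n)%R); last first.
  move=> p _; rewrite big_tuple (eq_bigr (fun=> #|` walk_steps S|%:R^-1)%R).
    by rewrite prodr_const card_ord.
  by move=> i _; rewrite /step_prob fsvalP.
by rewrite sumr_const mulr_natl cardsE.
Qed.

Lemma walk_prob_rcons r s n : coxeter_system S ->
    reduced_word S (rcons r s) (word_prod r * s) ->
  (walk_prob S n (word_prod r * s) <= walk_prob S n (word_prod r))%R.
Proof.
move=> coxS red; rewrite !walk_probE ler_wpM2r ?exprn_ge0 ?invr_ge0 ?ler0n // ler_nat.
have sS : s \in S by case: red => + _ _; apply; rewrite mem_rcons mem_head.
have ss : s * s = 1 by case: coxS => m [_ /coxeter_generator_sq ->].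
set t := s ^ (word_prod r)^-1.
(* Reflection preserves the length, so the default [p] is never taken. *)
pose f (p : n.-tuple (walk_steps S)) : n.-tuple (walk_steps S) :=
  insubd p (reflect_path t p).
have val_f p : val (f p) = reflect_path t p.
  by rewrite val_insubd size_reflect_path size_tuple eqxx.
have f_inj : injective f.
  by move=> p q /(congr1 val); rewrite !val_f => /(inv_inj (@reflect_pathK t))/val_inj.
rewrite -(card_imset _ f_inj); apply/subset_leq_card/subsetP => _ /imsetP[p + ->].
rewrite !inE => /eqP ep; rewrite [tval (f p)]val_f word_prod_reflect_path.
- by rewrite ep /t conjg_invE mulgA mulgVK -mulgA ss mulg1.
- by rewrite -conjMg ss conj1g.
- exact: walk_path_crosses ep.
Qed.

(** A shorter word for the prefix, followed by [v], would be a shorter word for [x]. *)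
Lemma reduced_word_catl (u v : seq W) x : reduced_word S (u ++ v) x ->
  reduced_word S u (word_prod u).
Proof.
case=> Suv uvx min_uv; split=> // [y yu|z Sz zu].
  by apply: Suv; rewrite mem_cat yu.
rewrite -(leq_add2r (size v)) -!size_cat; apply: min_uv; last first.
  by rewrite -uvx !word_prod_cat zu.
move=> y; rewrite mem_cat => /orP[/Sz //|yv].
by apply: Suv; rewrite mem_cat yv orbT.
Qed.

End Walk.

Theorem theorem1p1 (W : groupType) (S : {fset W}) (hS : coxeter_system S)
    (n : nat) (w w' : W) (hw : weak_le S w w') :
  (walk_prob S n w' <= walk_prob S n w)%R.
Proof.
(* Induction on [v] from its right end reduces the claim to appending one letter to a reduced
   word. *)
case: hw => u [v [[_ <- _]]]; elim/last_ind: v w' => [|v s IHv] w'.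
  by rewrite cats0 => -[_ -> _].
rewrite -rcons_cat => red; have [_ <- _] := red.
move: red; rewrite -cats1 => red.
have rs_prod : word_prod ((u ++ v) ++ [:: s]) = word_prod (u ++ v) * s.
  by rewrite word_prod_cat word_prod_cons word_prod_nil mulg1.
apply: le_trans (IHv _ (reduced_word_catl red)); rewrite rs_prod.
apply: walk_prob_rcons => //; rewrite -rs_prod -cats1.
by case: red => ? e ?; split=> // z; rewrite e; auto.
Qed.
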